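(* Let $n$ be a positive integer such that $2^{2^n}+1$ is prime. Then the system \[ \left\{\begin{array}{rcl} \forall i \in \{1,\ldots,n\}\ \ x_i \cdot x_i &=& x_{i+1} \\ x_{1}+1 &=& x_{n+2} \\ x_{n+2}+1 &=& x_{n+3} \\ x_{n+1}+1 &=& x_{n+4} \\ x_{n+3} \cdot x_{n+5} &=& x_{n+4} \end{array}\right. \] in the variables $x_1,\ldots,x_{n+5}$ has a unique solution $(a_1,\ldots,a_{n+5})$ in non-negative integers. The numbers $a_1,\ldots,a_{n+5}$ are positive and $\max(a_1,\ldots,a_{n+5})=a_{n+4}=\left(2^{2^n}-1\right)^{2^n}+1$. *)

(* Defs.v *)
From mathcomp Require Import all_boot.

Set Implicit Arguments.
Unset Strict Implicit.
Unset Printing Implicit Defensive.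

(* The paper's 1-based x_i; the default 0 is reached only for i > k
   (and i = 0 aliases i = 1), indices that never occur below. *)
Definition var (k : nat) (x : k.-tuple nat) (i : nat) : nat := nth 0 x i.-1.

Definition is_solution (n : nat) (x : (n + 5).-tuple nat) : Prop :=
  [/\ forall i : nat, 1 <= i <= n -> var x i * var x i = var x (i + 1),
      var x 1 + 1 = var x (n + 2),
      var x (n + 2) + 1 = var x (n + 3),
      var x (n + 1) + 1 = var x (n + 4)
    & var x (n + 3) * var x (n + 5) = var x (n + 4)].

(* Main.v *)
Require Import Defs.
From mathcomp Require Import all_boot zify.

(** All variables are determined by [a = x_1]: the squarings give
    [x_(n+1) = a ^ (2 ^ n)], and the last equation says that [a + 2] divides
    [a ^ (2 ^ n) + 1].  Since [a = -2] modulo [a + 2], this amounts to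
    [a + 2] dividing the Fermat prime [2 ^ (2 ^ n) + 1], and [a + 2 > 1] forces
    [a = 2 ^ (2 ^ n) - 1]. *)

(** The factorization of [a ^ 2 - 4] as [(a - 2) * (a + 2)], written without subtraction: [2 * (a +
    2) + a ^ 2 = a * (a + 2) + 2 ^ 2]. *)
Lemma sqrn_mod_add2 (a : nat) : a ^ 2 = 2 ^ 2 %[mod a + 2].
Proof. by rewrite -(modnMDl 2 (a ^ 2)) -(modnMDl a (2 ^ 2)); congr (_ %% _); lia. Qed.

(** Since [n] is positive, [2 ^ n] is even, so both powers are powers of squares and the sign of
    [-2] disappears. *)
Lemma dvdn_add2_expn_add1 (n a : nat) : 0 < n ->
  (a + 2 %| a ^ (2 ^ n) + 1) = (a + 2 %| 2 ^ (2 ^ n) + 1).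
Proof.
case: n => // n _; rewrite expnS !expnM /dvdn.
by rewrite -modnDml -modnXm sqrn_mod_add2 modnXm modnDml.
Qed.

Lemma dvdn_add2_Fermat_prime (n a : nat) : 0 < n -> prime (2 ^ (2 ^ n) + 1) ->
  (a + 2 %| a ^ (2 ^ n) + 1) = (a == 2 ^ (2 ^ n) - 1).
Proof.
move=> n_gt0 p_pr; rewrite dvdn_add2_expn_add1 //.
have p_gt0 := expn_gt0 2 (2 ^ n).
apply/idP/eqP => [|->]; last by have -> : 2 ^ (2 ^ n) - 1 + 2 = 2 ^ (2 ^ n) + 1 by lia.
by have /primeP[_ div_p] := p_pr => /div_p; lia.
Qed.

(* [solution_from n a i] is the value forced on the paper's [x_i] by [x_1 = a]. *)
Definition solution_from (n a i : nat) : nat :=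
  if i <= n + 1 then a ^ (2 ^ i.-1) else
  nth 0 [:: a + 1; a + 2; a ^ (2 ^ n) + 1; (a ^ (2 ^ n) + 1) %/ (a + 2)]
    (i - (n + 2)).

Lemma solution_from_tail (n a : nat) :
  [/\ solution_from n a (n + 2) = a + 1,
      solution_from n a (n + 3) = a + 2,
      solution_from n a (n + 4) = a ^ (2 ^ n) + 1
    & solution_from n a (n + 5) = (a ^ (2 ^ n) + 1) %/ (a + 2)].
Proof. by rewrite /solution_from !leq_add2l !subnDl. Qed.

Lemma index_cases (n i : nat) : 1 <= i <= n + 5 ->
  [\/ 1 <= i <= n + 1, i = n + 2, i = n + 3 | i = n + 4 \/ i = n + 5].
Proof.
move=> hi; have [le_in|lt_ni] := leqP i (n + 1); first by constructor 1; lia.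
have [->|ne2] := eqVneq i (n + 2); first by constructor 2.
have [->|ne3] := eqVneq i (n + 3); first by constructor 3.
by constructor 4; lia.
Qed.

(** Reduces the system to a divisibility condition on [x_1] alone, from which existence and
    uniqueness can both be read off. *)
Lemma is_solutionP (n : nat) (x : (n + 5).-tuple nat) :
  is_solution x <->
  (var x 1 + 2 %| var x 1 ^ (2 ^ n) + 1) /\
  (forall i, 1 <= i <= n + 5 -> var x i = solution_from n (var x 1) i).
Proof.
have [s2 s3 s4 s5] := solution_from_tail n (var x 1).
split=> [[sq e2 e3 e4 e5]|[dv sol]].
  have pow i : i <= n -> var x i.+1 = var x 1 ^ (2 ^ i).
    elim: i => [|i IHi] lt_in; first by rewrite expn1.
    by rewrite -[i.+2]addn1 -sq // IHi ?(ltnW lt_in) // mulnn -expnM -expnSr.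
  have e3' : var x (n + 3) = var x 1 + 2 by lia.
  have e4' : var x (n + 4) = var x 1 ^ (2 ^ n) + 1 by rewrite -e4 [n + 1]addn1 pow.
  rewrite e3' e4' in e5; split; first by rewrite -e5 dvdn_mulr.
  move=> i /index_cases[/andP[i_gt0 le_in]|->|->|[->|->]].
  - by rewrite /solution_from le_in -pow ?prednK; lia.
  - by rewrite s2 e2.
  - by rewrite s3.
  - by rewrite s4.
  (* The factor [x_1 + 2] is positive, so it cancels in the last equation. *)
  - by rewrite s5 -e5 mulKn // addn2.
have [e2 e3 e4 e5] : [/\ var x (n + 2) = var x 1 + 1,
    var x (n + 3) = var x 1 + 2, var x (n + 4) = var x 1 ^ (2 ^ n) + 1
  & var x (n + 5) = (var x 1 ^ (2 ^ n) + 1) %/ (var x 1 + 2)].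
  by split; [rewrite -s2 | rewrite -s3 | rewrite -s4 | rewrite -s5]; apply: sol; lia.
have pow i : i <= n -> var x i.+1 = var x 1 ^ (2 ^ i).
  by move=> le_in; rewrite sol /solution_from; [rewrite addn1 ltnS le_in | lia].
split; rewrite ?e2 ?e3 ?e4 ?e5 //.
- case=> // i lt_in; rewrite addn1 (pow i.+1) // (pow i); last by lia.
  by rewrite mulnn -expnM -expnSr.
- by rewrite -addnA.
- by rewrite [n + 1]addn1 pow.
(* The divisibility [dv] makes the truncated quotient exact. *)
- by rewrite mulnC divnK.
Qed.

(** Ordinals count from 0 and [var] from 1, hence the successor. *)
Lemma var_mktuple (k : nat) (f : nat -> nat) (i : nat) : 1 <= i <= k ->
  var [tuple f (val j).+1 | j < k] i = f i.
Proof.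
case: i => // i lt_ik; rewrite /var.
by rewrite -[i.+1.-1]/(val (Ordinal lt_ik)) -tnth_nth tnth_mktuple.
Qed.

Lemma eq_from_var (k : nat) (x y : k.-tuple nat) :
  (forall i, 1 <= i <= k -> var x i = var y i) -> x = y.
Proof.
move=> eq_xy; apply: eq_from_tnth => j; rewrite !(tnth_nth 0).
exact: (eq_xy (val j).+1 (ltn_ord j)).
Qed.

Lemma solution_from_gt0 (n a i : nat) : 0 < a ->
  a + 2 %| a ^ (2 ^ n) + 1 -> 1 <= i <= n + 5 -> 0 < solution_from n a i.
Proof.
move=> a_gt0 dv; have [s2 s3 s4 s5] := solution_from_tail n a.
case/index_cases=> [/andP[_ le_in]|->|->|[->|->]]; rewrite ?s2 ?s3 ?s4 ?s5; try lia.
by rewrite /solution_from le_in expn_gt0 a_gt0.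
Qed.

Lemma leq_solution_from (n a i : nat) : 0 < n -> 1 < a -> 1 <= i <= n + 5 ->
  solution_from n a i <= solution_from n a (n + 4).
Proof.
move=> n_gt0 a_gt1; have [s2 s3 s4 s5] := solution_from_tail n a.
have a_gt0 : 0 < a by lia.
have le_sq : a ^ 2 <= a ^ (2 ^ n) by rewrite leq_pexp2l // -{1}(expn1 2) leq_pexp2l.
(* This is where [1 < a] matters: it bounds the entry [a + 2] by [a ^ (2 ^ n) + 1], and it fails for
   [a = 1]. *)
have le_a2 : a + 1 <= a ^ 2 by nia.
case/index_cases=> [/andP[i_gt0 le_in]|->|->|[->|->]]; rewrite s4 ?s2 ?s3 ?s5 //; try lia.
rewrite /solution_from le_in.
have : a ^ (2 ^ i.-1) <= a ^ (2 ^ n) by rewrite !leq_pexp2l //; lia.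
by lia.
Qed.

Theorem theorem3 (n : nat) (hn : 0 < n) (hp : prime (2 ^ (2 ^ n) + 1)) :
  exists a : (n + 5).-tuple nat,
    [/\ unique (@is_solution n) a,
        forall i : nat, 1 <= i <= n + 5 -> 0 < var a i,
        \max_(1 <= i < (n + 5).+1) var a i = var a (n + 4)
      & var a (n + 4) = (2 ^ (2 ^ n) - 1) ^ (2 ^ n) + 1].
Proof.
set c := 2 ^ (2 ^ n) - 1.
have c_gt1 : 1 < c.
  have : 2 ^ 2 <= 2 ^ (2 ^ n) by rewrite leq_pexp2l // -{1}(expn1 2) leq_pexp2l.
  by rewrite /c; lia.
have c_dvd : c + 2 %| c ^ (2 ^ n) + 1 by rewrite dvdn_add2_Fermat_prime.
pose a := [tuple solution_from n c (val j).+1 | j < n + 5].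
have aE i : 1 <= i <= n + 5 -> var a i = solution_from n c i.
  exact: var_mktuple.
have a1 : var a 1 = c by rewrite aE /solution_from ?addn1 ?expn1 //; lia.
have [_ _ s4 _] := solution_from_tail n c.
exists a; split; last by rewrite aE ?s4 //; lia.
- split; first by apply/is_solutionP; rewrite a1.
  (* Primality forces [x_1 = c] for any solution, and [x_1] determines every other entry. *)
  move=> x /is_solutionP[]; rewrite dvdn_add2_Fermat_prime // => /eqP-> xE.
  by apply: eq_from_var => i hi; rewrite aE // xE.
- by move=> i hi; rewrite aE // solution_from_gt0 // ltnW.
- apply/eqP; rewrite eqn_leq; apply/andP; split.
    apply/bigmax_leqP_seq => i; rewrite mem_index_iota ltnS => hi _.
    by rewrite !aE ?leq_solution_from //; lia.
  (* The index [n + 4] lies in the range, so the bound is attained. *)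
  by apply: leq_bigmax_seq => //; rewrite mem_index_iota; lia.
Qed.
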